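(* Let $R$ be a vector space over $\mathbb{C}$ equipped with a linear operator $\partial$ and let $Y_-^0$ be a linear map from $R$ to $\mathrm{Hom}(R,x^{-1}R[x^{-1}])$. Let $S(R)$ be the symmetric algebra over $R$ and extend $\partial$ (uniquely) to a derivation of $S(R)$. Then $Y_-^0$ extends to a vertex Poisson algebra structure $Y_-$ on the differential algebra $(S(R),\partial)$ if and only if $(R,\partial,Y_-^0)$ carries the structure of a vertex Lie algebra. Furthermore, such an extension is unique.
   Context: A differential algebra is a commutative associative $\mathbb{C}$-algebra $A$ with identity $1$ equipped with a derivation $\partial$. Vertex Lie algebra: a vector space $A$ with a linear operator $\partial$ and bilinear products $(a,b)\mapsto a_nb$ ($n\in\mathbb{N}=\{0,1,2,\dots\}$) such that for $a,b,c\in A$, $m,n\in\mathbb{N}$: (C0) $a_nb=0$ for $n$ sufficiently large; (C1) $(\partial a)_nb=-n\,a_{n-1}b$ (which is $0$ for $n=0$); (C2) $a_nb=\sum_{i\ge0}(-1)^{n+i+1}\frac{1}{i!}\partial^i(b_{n+i}a)$; (C3) $a_mb_nc-b_na_mc=\sum_{i=0}^m\binom{m}{i}(a_ib)_{m+n-i}c$. The products are encoded in the linear map $Y_-:A\to\mathrm{Hom}(A,x^{-1}A[x^{-1}])$, $Y_-(a,x)=\sum_{n\ge0}a_nx^{-n-1}$, and the structure is denoted $(Y_-,\partial)$. Vertex Poisson algebra: a differential algebra $(A,\partial)$ with a vertex Lie algebra structure $(Y_-,\partial)$ (same $\partial$) such that $a_n(bc)=(a_nb)c+b(a_nc)$ for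 all $a,b,c\in A$, $n\ge0$. That $Y_-$ extends $Y_-^0$ means $Y_-(u,x)v=Y_-^0(u,x)v$ for $u,v\in R\subset S(R)$. *)

(* Defs.v *)
From HB Require Import structures.
From mathcomp Require Import all_boot all_algebra generic_quotient.
From mathcomp Require Import boolp classical_sets fsbigop reals.
From mathcomp Require Import complex.

Set Implicit Arguments.
Unset Strict Implicit.
Unset Printing Implicit Defensive.

Import GRing.Theory.
Local Open Scope ring_scope.
Local Open Scope quotient_scope.

(* The symmetric algebra S(V), as the commutative unital F-algebra presented by
   the generators v in V and the relations making v |-> v linear: formal
   algebra expressions modulo the congruence generated by the axioms. Its
   universal property is [symalg_universal]; V embeds by [symgen]. *)
Section SymmetricAlgebra.
Variables (F : fieldType) (V : lmodType F).

Inductive symterm : Type :=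
| SGen of V
| SConst of F
| SAdd of symterm & symterm
| SMul of symterm & symterm.

HB.instance Definition _ := gen_eqMixin symterm.
HB.instance Definition _ := gen_choiceMixin symterm.

Inductive symeq : symterm -> symterm -> Prop :=
| symeq_refl s : symeq s s
| symeq_sym s t : symeq s t -> symeq t s
| symeq_trans s t u : symeq s t -> symeq t u -> symeq s u
| symeq_add s s' t t' : symeq s s' -> symeq t t' -> symeq (SAdd s t) (SAdd s' t')
| symeq_mul s s' t t' : symeq s s' -> symeq t t' -> symeq (SMul s t) (SMul s' t')
| symeq_addA s t u : symeq (SAdd s (SAdd t u)) (SAdd (SAdd s t) u)
| symeq_addC s t : symeq (SAdd s t) (SAdd t s)
| symeq_add0 s : symeq (SAdd (SConst 0) s) s
| symeq_mulA s t u : symeq (SMul s (SMul t u)) (SMul (SMul s t) u)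
| symeq_mulC s t : symeq (SMul s t) (SMul t s)
| symeq_mul1 s : symeq (SMul (SConst 1) s) s
| symeq_mul0 s : symeq (SMul (SConst 0) s) (SConst 0)
| symeq_mulDl s t u : symeq (SMul (SAdd s t) u) (SAdd (SMul s u) (SMul t u))
| symeq_constD a b : symeq (SConst (a + b)) (SAdd (SConst a) (SConst b))
| symeq_constM a b : symeq (SConst (a * b)) (SMul (SConst a) (SConst b))
| symeq_genD u v : symeq (SGen (u + v)) (SAdd (SGen u) (SGen v))
| symeq_genZ a v : symeq (SGen (a *: v)) (SMul (SConst a) (SGen v)).

Definition symeqb (s t : symterm) : bool := `[< symeq s t >].

Fact symeqb_equiv : equiv_class_of symeqb.
Proof.
split.
- by move=> s; apply/asboolP/symeq_refl.
- by move=> s t; apply/asboolP/asboolP => /symeq_sym.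
- by move=> t s u /asboolP st /asboolP tu; apply/asboolP/(symeq_trans st tu).
Qed.

Canonical symeqb_equivRel := EquivRelPack symeqb_equiv.

Definition symalg : Type := {eq_quot symeqb}.
HB.instance Definition _ := Choice.on symalg.
HB.instance Definition _ := EqQuotient.on symalg.

Definition symcl (t : symterm) : symalg := \pi_symalg t.

Lemma symclP s t : symcl s = symcl t <-> symeq s t.
Proof.
by split=> [/eqmodP/asboolP // | st]; apply/eqmodP/asboolP.
Qed.

Lemma symclK (x : symalg) : symcl (repr x) = x.
Proof. exact: reprK. Qed.

Lemma symcl_ind (P : symalg -> Prop) : (forall t, P (symcl t)) -> forall x, P x.
Proof. by move=> Pt x; rewrite -[x]symclK. Qed.

Definition symadd (x y : symalg) : symalg := symcl (SAdd (repr x) (repr y)).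
Definition symmul (x y : symalg) : symalg := symcl (SMul (repr x) (repr y)).
Definition symscale (a : F) (x : symalg) : symalg :=
  symcl (SMul (SConst a) (repr x)).
Definition symopp : symalg -> symalg := symscale (-1).

Lemma symeq_repr t : symeq (repr (symcl t)) t.
Proof. by apply/symclP; rewrite symclK. Qed.

Lemma symaddE s t : symadd (symcl s) (symcl t) = symcl (SAdd s t).
Proof. by apply/symclP/symeq_add; apply: symeq_repr. Qed.

Lemma symmulE s t : symmul (symcl s) (symcl t) = symcl (SMul s t).
Proof. by apply/symclP/symeq_mul; apply: symeq_repr. Qed.

Lemma symscaleE a t : symscale a (symcl t) = symcl (SMul (SConst a) t).
Proof. by apply/symclP/symeq_mul; [apply: symeq_refl | apply: symeq_repr]. Qed.

Fact symaddA : associative symadd.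
Proof.
elim/symcl_ind=> s; elim/symcl_ind=> t; elim/symcl_ind=> u.
by rewrite !symaddE; apply/symclP/symeq_addA.
Qed.

Fact symaddC : commutative symadd.
Proof.
elim/symcl_ind=> s; elim/symcl_ind=> t.
by rewrite !symaddE; apply/symclP/symeq_addC.
Qed.

Fact symadd0 : left_id (symcl (SConst 0)) symadd.
Proof. by elim/symcl_ind=> s; rewrite symaddE; apply/symclP/symeq_add0. Qed.

Fact symscaleDl (x : symalg) (a b : F) :
  symscale (a + b) x = symadd (symscale a x) (symscale b x).
Proof.
elim/symcl_ind: x => t; rewrite !symscaleE symaddE; apply/symclP.
apply: symeq_trans (symeq_mulDl _ _ _).
exact: symeq_mul (symeq_constD _ _) (symeq_refl _).
Qed.

Fact symscale1 : left_id 1 symscale.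
Proof. by elim/symcl_ind=> t; rewrite symscaleE; apply/symclP/symeq_mul1. Qed.

Fact symaddN : left_inverse (symcl (SConst 0)) symopp symadd.
Proof.
elim/symcl_ind=> t; rewrite -[X in symadd _ X]symscale1 -symscaleDl addNr.
by rewrite symscaleE; apply/symclP/symeq_mul0.
Qed.

HB.instance Definition _ :=
  GRing.isZmodule.Build symalg symaddA symaddC symadd0 symaddN.

Fact symmulA : associative symmul.
Proof.
elim/symcl_ind=> s; elim/symcl_ind=> t; elim/symcl_ind=> u.
by rewrite !symmulE; apply/symclP/symeq_mulA.
Qed.

Fact symmulC : commutative symmul.
Proof.
elim/symcl_ind=> s; elim/symcl_ind=> t.
by rewrite !symmulE; apply/symclP/symeq_mulC.
Qed.

Fact symmul1 : left_id (symcl (SConst 1)) symmul.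
Proof. by elim/symcl_ind=> s; rewrite symmulE; apply/symclP/symeq_mul1. Qed.

Fact symmulDl : left_distributive symmul symadd.
Proof.
elim/symcl_ind=> s; elim/symcl_ind=> t; elim/symcl_ind=> u.
by rewrite !(symmulE, symaddE); apply/symclP/symeq_mulDl.
Qed.

Fixpoint symterm_eval (B : comAlgType F) (f : V -> B) (t : symterm) : B :=
  match t with
  | SGen v => f v
  | SConst a => a%:A
  | SAdd s t => symterm_eval f s + symterm_eval f t
  | SMul s t => symterm_eval f s * symterm_eval f t
  end.

Lemma symterm_eval_eq (B : comAlgType F) (f : {linear V -> B}) s t :
  symeq s t -> symterm_eval f s = symterm_eval f t.
Proof.
elim=> //= {s t}.
- by move=> s t u _ -> _ ->.
- by move=> s s' t t' _ -> _ ->.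
- by move=> s s' t t' _ -> _ ->.
- by move=> *; rewrite addrA.
- by move=> *; rewrite addrC.
- by move=> *; rewrite scale0r add0r.
- by move=> *; rewrite mulrA.
- by move=> *; rewrite mulrC.
- by move=> *; rewrite scale1r mul1r.
- by move=> *; rewrite scale0r mul0r.
- by move=> *; rewrite mulrDl.
- by move=> *; rewrite scalerDl.
- by move=> *; rewrite mulr_algl scalerA.
- by move=> *; rewrite linearD.
- by move=> *; rewrite linearZ /= mulr_algl.
Qed.

Fact symone_neq0 : symcl (SConst 1) != symcl (SConst 0).
Proof.
apply/eqP => /symclP /(@symterm_eval_eq F^o (\0 : V -> F^o)).
by move/eqP; rewrite /= scale1r scale0r oner_eq0.
Qed.

HB.instance Definition _ := GRing.Zmodule_isComNzRing.Build symalg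
  symmulA symmulC symmul1 symmulDl symone_neq0.

Fact symscaleM (a b : F) (x : symalg) :
  symscale a (symscale b x) = symscale (a * b) x.
Proof.
elim/symcl_ind: x => t; rewrite !symscaleE; apply/symclP.
apply: symeq_trans (symeq_mulA _ _ _) _.
exact: symeq_mul (symeq_sym (symeq_constM _ _)) (symeq_refl _).
Qed.

Fact symscaleE_mul a (x : symalg) : symscale a x = symmul (symcl (SConst a)) x.
Proof. by elim/symcl_ind: x => t; rewrite symscaleE symmulE. Qed.

Fact symscaleDr : right_distributive symscale +%R.
Proof. by move=> a x y; rewrite !symscaleE_mul; apply: mulrDr. Qed.

Fact symscaleDl_morph (x : symalg) : {morph symscale^~ x : a b / a + b}.
Proof. by move=> a b; apply: symscaleDl. Qed.

HB.instance Definition _ := GRing.Zmodule_isLmodule.Build F symalg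
  symscaleM symscale1 symscaleDr symscaleDl_morph.

Fact symscaleAl a (x y : symalg) : a *: (x * y) = (a *: x) * y.
Proof. by rewrite /GRing.scale /= !symscaleE_mul; apply: mulrA. Qed.

HB.instance Definition _ := GRing.Lmodule_isLalgebra.Build F symalg symscaleAl.
HB.instance Definition _ := GRing.Lalgebra_isComAlgebra.Build F symalg.

Definition symgen (v : V) : symalg := symcl (SGen v).

Fact symgen_linear : linear symgen.
Proof.
move=> a u v; rewrite /GRing.scale /= /GRing.add /= symscaleE symaddE.
apply/symclP; apply: symeq_trans (symeq_genD _ _) _.
exact: symeq_add (symeq_genZ _ _) (symeq_refl _).
Qed.

HB.instance Definition _ :=
  GRing.isLinear.Build F V symalg *:%R symgen symgen_linear.

Lemma symcl_const a : symcl (SConst a) = a%:A.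
Proof.
rewrite /GRing.scale /= symscaleE_mul.
by rewrite -[LHS](mulr1 (symcl _ : symalg)).
Qed.

Lemma symalg_ind (P : symalg -> Prop) :
  (forall v, P (symgen v)) -> (forall a : F, P a%:A) ->
  (forall x y, P x -> P y -> P (x + y)) ->
  (forall x y, P x -> P y -> P (x * y)) ->
  forall x, P x.
Proof.
move=> Pg Pc PD PM; elim/symcl_ind; elim=> [v|a|s Ps t Pt|s Ps t Pt].
- exact: Pg.
- by rewrite symcl_const.
- by rewrite -symaddE; apply: PD.
- by rewrite -symmulE; apply: PM.
Qed.

Lemma symalg_universal (B : comAlgType F) (f : {linear V -> B}) :
  exists2 g : {lrmorphism symalg -> B}, (forall v, g (symgen v) = f v) &
    forall g' : {lrmorphism symalg -> B},
      (forall v, g' (symgen v) = f v) -> g' =1 g.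
Proof.
pose h (x : symalg) := symterm_eval f (repr x).
have hE t : h (symcl t) = symterm_eval f t.
  exact: symterm_eval_eq (symeq_repr t).
have hL : linear h.
  move=> a; elim/symcl_ind=> s; elim/symcl_ind=> t.
  rewrite /GRing.scale /= /GRing.add /= symscaleE symaddE !hE /=.
  by rewrite mulr_algl.
have hM : monoid_morphism h.
  split; first by rewrite /GRing.one /= hE /= scale1r.
  elim/symcl_ind=> s; elim/symcl_ind=> t.
  by rewrite /GRing.mul /= symmulE !hE.
pose hLm := GRing.isLinear.Build F symalg B *:%R h hL.
pose hMm := GRing.isMonoidMorphism.Build symalg B h hM.
pose g : {lrmorphism symalg -> B} := HB.pack h hLm hMm.
have gE v : g (symgen v) = f v by rewrite /= /symgen hE.
exists g => // g' g'E; apply: symalg_ind => [v|a|x y ex ey|x y ex ey].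
- by rewrite gE g'E.
- by rewrite !linearZ !rmorph1.
- by rewrite (raddfD g') (raddfD g) /= ex ey.
- by rewrite (rmorphM g') (rmorphM g) /= ex ey.
Qed.

(* The evaluation of expressions in the algebra F (+) V with V V = 0. *)
Fixpoint symterm_lin (t : symterm) : F * V :=
  match t with
  | SGen v => (0, v)
  | SConst a => (a, 0)
  | SAdd s t => symterm_lin s + symterm_lin t
  | SMul s t => let x := symterm_lin s in let y := symterm_lin t in
      (x.1 * y.1, x.1 *: y.2 + y.1 *: x.2)
  end.

Lemma symterm_lin_eq s t : symeq s t -> symterm_lin s = symterm_lin t.
Proof.
elim=> //= {s t}.
- by move=> s t u _ -> _ ->.
- by move=> s s' t t' _ -> _ ->.
- by move=> s s' t t' _ -> _ ->.
- by move=> *; rewrite addrA.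
- by move=> *; rewrite addrC.
- by move=> *; rewrite add0r.
- move=> s t u; rewrite mulrA !scalerDr !scalerA addrA.
  by congr (_, _ + _ + _); congr (_ *: _); apply: mulrC.
- by move=> s t; rewrite mulrC addrC.
- by move=> s; rewrite mul1r scale1r scaler0 addr0; case: symterm_lin.
- by move=> s; rewrite mul0r scale0r scaler0 addr0.
- move=> s t u; congr (_, _); first exact: mulrDl.
  by rewrite scalerDl scalerDr addrACA.
- by move=> a b; congr (_, _); rewrite /= addr0.
- by move=> a b; rewrite !scaler0 addr0.
- by move=> u v; congr (_, _); rewrite /= addr0.
- by move=> a v; rewrite mulr0 scaler0 addr0.
Qed.

Lemma symgen_inj : injective symgen.
Proof. by move=> u v /symclP /symterm_lin_eq []. Qed.

Fixpoint symterm_der (f : V -> symalg) (t : symterm) : symalg :=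
  match t with
  | SGen v => f v
  | SConst _ => 0
  | SAdd s t => symterm_der f s + symterm_der f t
  | SMul s t => symterm_der f s * symcl t + symcl s * symterm_der f t
  end.

(* The derivation extending a linear f : V -> S(V), by [symder_gen],
   [symder_derivation] and [symder_unique]. *)
Definition symder (f : V -> symalg) (x : symalg) : symalg :=
  symterm_der f (repr x).

End SymmetricAlgebra.

Definition is_derivation (F : fieldType) (A : comAlgType F) (D : A -> A) : Prop :=
  linear D /\ forall a b, D (a * b) = D a * b + a * D b.

Section Derivation.
Variables (F : fieldType) (V : lmodType F) (f : {linear V -> symalg V}).

Lemma symterm_der_eq s t : symeq s t -> symterm_der f s = symterm_der f t.
Proof.
have addE (s' t' : symterm V) : symcl (SAdd s' t') = symcl s' + symcl t'.
  by rewrite -symaddE.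
have mulE (s' t' : symterm V) : symcl (SMul s' t') = symcl s' * symcl t'.
  by rewrite -symmulE.
have clE := @symcl_const F V.
elim=> //= {s t}.
- by move=> s t u _ -> _ ->.
- by move=> s s' t t' _ -> _ ->.
- by move=> s s' t t' /symclP -> -> /symclP -> ->.
- by move=> *; rewrite addrA.
- by move=> *; rewrite addrC.
- by move=> *; rewrite add0r.
- by move=> *; rewrite !mulE !mulrDl !mulrDr !mulrA addrA.
- by move=> *; rewrite addrC mulrC [X in _ + X]mulrC.
- by move=> *; rewrite clE scale1r mul1r mul0r add0r.
- by move=> *; rewrite clE scale0r !mul0r add0r.
- by move=> *; rewrite addE !mulrDl addrACA.
- by rewrite addr0.
- by move=> *; rewrite mul0r mulr0 addr0.
- by move=> *; rewrite linearD.
- by move=> *; rewrite clE mul0r add0r linearZ /= mulr_algl.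
Qed.

Lemma symder_gen v : symder f (symgen v) = f v.
Proof. exact: symterm_der_eq (symeq_repr _). Qed.

Lemma symder_derivation : is_derivation (symder f).
Proof.
have dE t : symder f (symcl t) = symterm_der f t.
  exact: symterm_der_eq (symeq_repr _).
split.
  move=> a; elim/symcl_ind=> s; elim/symcl_ind=> t.
  rewrite -mulr_algl -symcl_const {1}/GRing.add {1}/GRing.mul /=.
  rewrite symmulE symaddE !dE /= mul0r add0r.
  by rewrite symcl_const mulr_algl.
elim/symcl_ind=> s; elim/symcl_ind=> t.
by rewrite {1}/GRing.mul /= symmulE !dE.
Qed.

Lemma symder_unique (D : symalg V -> symalg V) : is_derivation D ->
  (forall v, D (symgen v) = f v) -> D =1 symder f.
Proof.
have dE t : symder f (symcl t) = symterm_der f t.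
  exact: symterm_der_eq (symeq_repr _).
move=> [DL DM] Dgen.
have D0 : D 0 = 0.
  by apply: (addrI (D 0)); rewrite addr0 -{1}[D 0]scale1r -DL scaler0 addr0.
have DD x y : D (x + y) = D x + D y by rewrite -{1}[x]scale1r DL scale1r.
have D1 : D 1 = 0.
  by apply: (addrI (D 1)); rewrite addr0 -{3}[1]mulr1 DM mulr1 mul1r.
have DZ a : D (a%:A) = 0 by rewrite -[_%:A]addr0 DL D0 D1 scaler0 addr0.
elim/symcl_ind; elim=> [v|a|s Ps t Pt|s Ps t Pt].
- by rewrite dE Dgen.
- by rewrite symcl_const DZ -symcl_const dE.
- by rewrite dE -symaddE DD Ps Pt !dE.
- by rewrite dE -symmulE DM Ps Pt !dE.
Qed.

End Derivation.

(* A linear map Y_- : A -> Hom(A, x^-1 A[x^-1]) is given by its coefficients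
   a_n b = Y n a b, where Y_-(a, x) b is the sum of the a_n b x^(-n-1). *)
Section VertexStructures.
Variable F : numFieldType.

Record linear_to_polar (A : lmodType F) (Y : nat -> A -> A -> A) : Prop := {
  polar_linearl : forall n b, linear (fun a => Y n a b);
  polar_linearr : forall n a, linear (Y n a);
  polar_trunc : forall a b, exists N, forall n, (N <= n)%N -> Y n a b = 0
}.

(* In [vla_skew] the sum over all i in nat is finitely supported, by
   [polar_trunc]; in [vla_der] the right-hand side is 0 when n = 0. *)
Record vertex_Lie_algebra (A : lmodType F) (D : A -> A)
    (Y : nat -> A -> A -> A) : Prop := {
  vla_linear : linear D;
  vla_polar : linear_to_polar Y;
  vla_der : forall n a b, Y n (D a) b = - (Y n.-1 a b *+ n);
  vla_skew : forall n a b, Y n a b =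
    \sum_(i \in [set: nat])
      ((-1) ^+ (n + i + 1) / i`!%:R : F) *: iter i D (Y (n + i)%N b a);
  vla_comm : forall m n a b c,
    Y m a (Y n b c) - Y n b (Y m a c) =
    \sum_(0 <= i < m.+1) Y (m + n - i)%N (Y i a b) c *+ 'C(m, i)
}.

Record vertex_Poisson_algebra (A : comAlgType F) (D : A -> A)
    (Y : nat -> A -> A -> A) : Prop := {
  vpa_derivation : is_derivation D;
  vpa_vla : vertex_Lie_algebra D Y;
  vpa_leibniz : forall n a b c, Y n a (b * c) = Y n a b * c + b * Y n a c
}.

Definition polar_extends (V : lmodType F)
    (Y0 : nat -> V -> V -> V) (Y : nat -> symalg V -> symalg V -> symalg V) :=
  forall n u v, Y n (symgen u) (symgen v) = symgen (Y0 n u v).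

End VertexStructures.

(* Main.v *)
(* Restriction to R is immediate since R embeds in S(R). Conversely, each a_n
   must be a derivation, so that u_n (u in R) is determined on S(R) by the
   u_n v; skew-symmetry then forces the values a_n v for v in R, hence the
   derivation a_n. This gives uniqueness, and a candidate for existence. For
   the candidate, (C1) is checked on generators; (C2) follows by induction on
   b from a Leibniz rule in the left argument; the Jacobi identity (C3), whose
   two sides are derivations in c, holds for all c as soon as it holds for c in
   R, and its invariance under permutations of (a, b, c) (a consequence of (C1)
   and (C2)) allows to reach all three arguments one after the other. *)

From HB Require Import structures.
Require Import Defs.
From mathcomp Require Import all_boot all_algebra.
From mathcomp Require Import ring.
From mathcomp Require Import boolp classical_sets fsbigop reals complex.

Set Implicit Arguments.
Unset Strict Implicit.
Unset Printing Implicit Defensive.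

Import GRing.Theory Num.Theory.
Local Open Scope ring_scope.

(** * Finite sums over the natural numbers *)

Section NatSums.
Variable V : zmodType.

Lemma sum_nat_widen (f : nat -> V) M N : (M <= N)%N ->
  (forall i, (M <= i)%N -> f i = 0) ->
  \sum_(0 <= i < N) f i = \sum_(0 <= i < M) f i.
Proof.
move=> MN f0; rewrite (big_cat_nat (n := M))//=.
rewrite [X in _ + X]big_nat_cond [X in _ + X]big1 ?addr0//.
by move=> i /andP[/andP[/f0]].
Qed.

(** The sum on the left is 0 by default when the support is infinite, so a bound on the support is
    needed before it can be manipulated. *)
Lemma fsum_nat (f : nat -> V) N : (forall i, (N <= i)%N -> f i = 0) ->
  \sum_(i \in [set: nat]) f i = \sum_(0 <= i < N) f i.
Proof.
move=> f0; rewrite (fsbigE (index_iota 0 N))//; last first.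
  by move=> i _; rewrite mem_index_iota -leqNgt => /f0.
- by rewrite iota_uniq.
by apply: eq_bigl => i; rewrite in_setT.
Qed.

Lemma sum_triangle (g : nat -> nat -> V) N :
  \sum_(0 <= s < N) \sum_(0 <= k < s.+1) g k (s - k)%N =
  \sum_(0 <= k < N) \sum_(0 <= l < N - k) g k l.
Proof.
elim: N => [|N IH]; first by rewrite !big_geq.
rewrite big_nat_recr//= IH.
have -> : \sum_(0 <= k < N) \sum_(0 <= l < N - k) g k l =
          \sum_(0 <= k < N.+1) \sum_(0 <= l < N - k) g k l.
  by rewrite big_nat_recr//= subnn [X in _ + X]big_geq// addr0.
rewrite -big_split/=; apply: eq_big_nat => k /= kN.
by rewrite subSn// big_nat_recr.
Qed.

Lemma sum_triangle_widen (g : nat -> nat -> V) N :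
  (forall k l, (N <= k + l)%N -> g k l = 0) ->
  \sum_(0 <= s < N) \sum_(0 <= k < s.+1) g k (s - k)%N =
  \sum_(0 <= k < N) \sum_(0 <= l < N) g k l.
Proof.
move=> g0; rewrite sum_triangle; apply: eq_bigr => k _.
rewrite [RHS](sum_nat_widen (M := N - k))//; first exact: leq_subr.
by move=> l; rewrite leq_subLR => /g0.
Qed.

(** Pascal's rule, in the form that suits inductions on the upper binomial index. *)
Lemma sum_binS (f : nat -> V) m :
  \sum_(0 <= i < m.+2) f i *+ 'C(m.+1, i) =
  \sum_(0 <= i < m.+1) (f i + f i.+1) *+ 'C(m, i).
Proof.
under [RHS]eq_bigr do rewrite mulrnDl.
rewrite big_split/= big_nat_recl// bin0.
under eq_bigr do rewrite binS mulrnDr.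
rewrite big_split/= addrA; congr (_ + _).
rewrite [RHS]big_nat_recl// bin0; congr (_ + _).
by rewrite big_nat_recr//= bin_small ?addr0.
Qed.

End NatSums.

Lemma signr_eq (R : pzRingType) m n : odd m = odd n ->
  (-1) ^+ m = (-1) ^+ n :> R.
Proof. by move=> mn; rewrite -[LHS]signr_odd mn signr_odd. Qed.

(** * Bare linear functions and finitely supported sequences *)

Section LinearFunctions.
Variables (F : pzRingType) (U V : lmodType F) (f : U -> V).
Hypothesis fL : linear f.

Let f' : {linear U -> V} := HB.pack f (GRing.isLinear.Build F U V *:%R f fL).

Lemma lin0 : f 0 = 0. Proof. exact: (linear0 f'). Qed.
Lemma linD x y : f (x + y) = f x + f y. Proof. exact: (linearD f'). Qed.
Lemma linN x : f (- x) = - f x. Proof. exact: (linearN f'). Qed.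
Lemma linZ a x : f (a *: x) = a *: f x. Proof. exact: (linearZ_LR f'). Qed.
Lemma linMn x n : f (x *+ n) = f x *+ n. Proof. exact: (linearMn f'). Qed.
Lemma lin_sum (r : seq nat) (g : nat -> U) :
  f (\sum_(i <- r) g i) = \sum_(i <- r) f (g i).
Proof. exact: (linear_sum f'). Qed.

End LinearFunctions.

Definition finite_seq (V : zmodType) (w : nat -> V) :=
  exists N, forall n, (N <= n)%N -> w n = 0.

Lemma finite_seq2 (V : zmodType) (v w : nat -> V) :
  finite_seq v -> finite_seq w ->
  exists N, forall n, (N <= n)%N -> v n = 0 /\ w n = 0.
Proof.
move=> [M v0] [N w0]; exists (maxn M N) => n; rewrite geq_max => /andP[? ?].
by split; [apply: v0|apply: w0].
Qed.

Lemma finite_seqD (V : zmodType) (v w : nat -> V) :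
  finite_seq v -> finite_seq w -> finite_seq (fun n => v n + w n).
Proof.
move=> hv hw; have [N h] := finite_seq2 hv hw.
by exists N => n /h[-> ->]; rewrite addr0.
Qed.

Lemma finite_seq_sum (V : zmodType) M (W : nat -> nat -> V) :
  (forall k, finite_seq (W k)) ->
  finite_seq (fun n => \sum_(0 <= k < M) W k n).
Proof.
move=> hW; elim: M => [|M IH]; first by exists 0%N => n _; rewrite big_geq.
have [N h] := finite_seqD IH (hW M).
by exists N => n /h; rewrite big_nat_recr.
Qed.

Lemma finite_seq_map (V W : zmodType) (f : nat -> V -> W) (w : nat -> V) :
  (forall n, f n 0 = 0) -> finite_seq w -> finite_seq (fun n => f n (w n)).
Proof. by move=> f0 [N w0]; exists N => n /w0 ->. Qed.

Lemma finite_seq_shift (V : zmodType) (w : nat -> V) k :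
  finite_seq w -> finite_seq (fun n => w (k + n)%N).
Proof. by move=> [N w0]; exists N => n Nn; apply/w0/(leq_trans Nn)/leq_addl. Qed.

(** * Divided powers of an operator and the skew-symmetry transform *)

Section SkewSum.
Variables (F : numFieldType) (A : lmodType F) (D : {linear A -> A}).

(** The divided power of [D]: the coefficient of [t^i] in [exp(t D)]. *)
Definition dpow i x : A := (i`!%:R^-1 : F) *: iter i D x.

(* With w(x) the sum of the w_n x^n / n!, these are the coefficients of
   - w(- x - D), so that skew-symmetry (C2) reads [a_n b = skew (b_* a) n]. *)
Definition skew (w : nat -> A) n : A :=
  \sum_(i \in [set: nat])
    ((-1) ^+ (n + i + 1) / i`!%:R : F) *: iter i D (w (n + i)%N).

Lemma iter_linear i : linear (iter i D).
Proof. by elim: i => [|i IH] a x y; rewrite ?iterS ?IH ?linearP. Qed.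

Lemma dpow_linear i : linear (dpow i).
Proof.
by move=> a x y; rewrite /dpow iter_linear scalerDr !scalerA mulrC.
Qed.

Lemma dpow0 x : dpow 0 x = x.
Proof. by rewrite /dpow fact0 invr1 scale1r. Qed.

Lemma D_dpow i x : D (dpow i x) = dpow i.+1 x *+ i.+1.
Proof.
rewrite /dpow (linearZ_LR D) -scaler_nat scalerA factS natrM invfM mulrA.
by rewrite divff ?mul1r// pnatr_eq0.
Qed.

Lemma dpow_D i x : dpow i (D x) = dpow i.+1 x *+ i.+1.
Proof. by rewrite -D_dpow /dpow (linearZ_LR D) -iterSr. Qed.

Lemma dpow_dpow i j x : dpow i (dpow j x) = dpow (i + j) x *+ 'C(i + j, i).
Proof.
rewrite /dpow (linZ (iter_linear i)) -iterD -scaler_nat !scalerA.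
congr (_ *: _); apply: (mulIf (x := (i`! * j`!)%:R)).
  by rewrite pnatr_eq0 -lt0n muln_gt0 !fact_gt0.
have := bin_fact (leq_addr j i); rewrite addKn => E.
rewrite [RHS]mulrAC -natrM E divff ?pnatr_eq0 -?lt0n ?fact_gt0//.
by rewrite natrM -invfM mulVf// mulf_neq0// pnatr_eq0 -lt0n fact_gt0.
Qed.

Lemma skew_nat N w n : (forall i, (N <= i)%N -> w i = 0) ->
  skew w n = \sum_(0 <= i < N) (-1) ^+ (n + i + 1) *: dpow i (w (n + i)%N).
Proof.
move=> w0; rewrite /skew (fsum_nat (N := N)).
  by apply: eq_bigr => i _; rewrite /dpow scalerA.
move=> i Ni; rewrite w0 ?(lin0 (iter_linear i)) ?scaler0//.
exact/(leq_trans Ni)/leq_addl.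
Qed.

Lemma skew_eq0 N w n : (forall i, (N <= i)%N -> w i = 0) -> (N <= n)%N ->
  skew w n = 0.
Proof.
move=> w0 Nn; rewrite (skew_nat n w0) big1// => i _.
by rewrite w0 ?(lin0 (dpow_linear i)) ?scaler0//; exact/(leq_trans Nn)/leq_addr.
Qed.

Lemma skew_finite w : finite_seq w -> finite_seq (skew w).
Proof. by move=> [N w0]; exists N => n; apply: skew_eq0. Qed.

Lemma eq_skew w w' n : w =1 w' -> skew w n = skew w' n.
Proof. by move=> /funext ->. Qed.

Lemma skew_linear a w w' n : finite_seq w -> finite_seq w' ->
  skew (fun m => a *: w m + w' m) n = a *: skew w n + skew w' n.
Proof.
move=> hw hw'; have [N w0] := finite_seq2 hw hw'.
have wN i : (N <= i)%N -> w i = 0 by move=> /w0[].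
have w'N i : (N <= i)%N -> w' i = 0 by move=> /w0[].
rewrite (skew_nat n wN) (skew_nat n w'N) (@skew_nat N); last first.
  by move=> i Ni; rewrite wN// w'N// scaler0 addr0.
rewrite scaler_sumr -big_split/=; apply: eq_bigr => i _.
by rewrite dpow_linear scalerDr scalerA [in RHS]scalerA mulrC.
Qed.

Lemma skewD w w' n : finite_seq w -> finite_seq w' ->
  skew (fun m => w m + w' m) n = skew w n + skew w' n.
Proof.
move=> hw hw'; rewrite -[skew w n]scale1r -skew_linear//.
by apply: eq_skew => m; rewrite scale1r.
Qed.

Lemma skew0 n : skew (fun=> 0) n = 0.
Proof. by apply: (@skew_eq0 0). Qed.

Lemma skewZ a w n : finite_seq w -> skew (fun m => a *: w m) n = a *: skew w n.
Proof.
move=> hw; rewrite -[RHS]addr0 -(skew0 n) -skew_linear//; last by exists 0.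
by apply: eq_skew => m; rewrite addr0.
Qed.

Lemma skewN w n : finite_seq w -> skew (fun m => - w m) n = - skew w n.
Proof.
move=> hw; rewrite -scaleN1r -skewZ//.
by apply: eq_skew => m; rewrite scaleN1r.
Qed.

Lemma skewMn k w n : finite_seq w -> skew (fun m => w m *+ k) n = skew w n *+ k.
Proof.
move=> hw; rewrite -scaler_nat -skewZ//.
by apply: eq_skew => m; rewrite scaler_nat.
Qed.

Lemma skew_sum M (W : nat -> nat -> A) n : (forall k, finite_seq (W k)) ->
  skew (fun m => \sum_(0 <= k < M) W k m) n = \sum_(0 <= k < M) skew (W k) n.
Proof.
move=> hW; elim: M => [|M IH].
  by rewrite [RHS]big_geq// -[RHS](skew0 n); apply: eq_skew => m; rewrite big_geq.
rewrite big_nat_recr//= -IH -skewD//; last exact: finite_seq_sum.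
by apply: eq_skew => m; rewrite big_nat_recr.
Qed.

Lemma skew_D w n : finite_seq w -> skew (fun m => D (w m)) n = D (skew w n).
Proof.
move=> [N w0]; rewrite !(@skew_nat N)//; last by move=> i /w0 ->; rewrite linear0.
rewrite linear_sum/=; apply: eq_bigr => i _.
by rewrite (linearZ_LR D) dpow_D D_dpow.
Qed.

(** The index shift differentiates [w(x)] [k] times; the sign is the chain rule for
    [x -> - x - D]. *)
Lemma skew_addl k w n : finite_seq w ->
  skew (fun m => w (k + m)%N) n = (-1) ^+ k *: skew w (k + n)%N.
Proof.
move=> [N w0]; rewrite (skew_nat _ w0) (@skew_nat N); last first.
  by move=> i Ni; apply/w0/(leq_trans Ni)/leq_addl.
rewrite scaler_sumr; apply: eq_bigr => i _; rewrite scalerA -exprD addnA.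
congr (_ *: _); apply: signr_eq; rewrite !oddD.
by case: (odd n); case: (odd k); case: (odd i).
Qed.

(** The sequence [m w_(m-1)] belongs to the series [x w(x)], and [x -> - x - D] turns the factor [x]
    into [- (x + D)]. *)
Lemma skew_pred w n : finite_seq w ->
  skew (fun m => w m.-1 *+ m) n = - (D (skew w n) + skew w n.-1 *+ n).
Proof.
move=> [N w0]; have w0' i : (N.+1 <= i)%N -> w i = 0 by move=> /ltnW/w0.
rewrite (@skew_nat N.+1); last by case=> // i /w0 ->; rewrite mul0rn.
(* The factor [n + i] is split: [i] is absorbed by the divided power and yields [D], while [n] goes
   with the lowered index. *)
have -> : \sum_(0 <= i < N.+1)
    (-1) ^+ (n + i + 1) *: dpow i (w (n + i).-1 *+ (n + i)) =
  \sum_(0 <= i < N.+1) ((-1) ^+ (n + i + 1) *: dpow i (w (n + i).-1)) *+ i +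
  \sum_(0 <= i < N.+1) ((-1) ^+ (n + i + 1) *: dpow i (w (n + i).-1)) *+ n.
  rewrite -big_split/=; apply: eq_bigr => i _.
  by rewrite (linMn (dpow_linear i)) -scalerMnr -mulrnDr [(i + n)%N]addnC.
rewrite opprD; congr (_ + _).
  rewrite big_nat_recl// mulr0n add0r (skew_nat n w0) linear_sum -sumrN/=.
  apply: eq_bigr => i _; rewrite (linearZ_LR D) D_dpow -scalerMnr !addnS !addn0/=.
  by rewrite exprS mulN1r scaleNr mulNrn. 
case: n => [|n]; first by rewrite big1// oppr0.
rewrite (skew_nat _ w0') -sumrMnl -sumrN/=; apply: eq_bigr => i _.
by rewrite !addSn exprS mulN1r scaleNr mulNrn.
Qed.

(** The substitution [x -> - x - D] is an involution. *)
Lemma skewK w n : finite_seq w -> skew (skew w) n = w n.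
Proof.
move=> [N w0]; rewrite (@skew_nat N.+1); last first.
  by move=> i /ltnW; apply: skew_eq0.
have w0' i : (N.+1 <= i)%N -> w i = 0 by move=> /ltnW/w0.
(* Grouped by the total power [s = k + l] of [D], the terms with [s > 0] carry an alternating sum of
   binomial coefficients, which vanishes. *)
pose g k l := (-1) ^+ l *: (dpow (k + l) (w (n + (k + l))%N) *+ 'C(k + l, k)).
transitivity (\sum_(0 <= k < N.+1) \sum_(0 <= l < N.+1) g k l).
  apply: eq_bigr => i _; rewrite (skew_nat _ w0') (lin_sum (dpow_linear i)).
  rewrite scaler_sumr; apply: eq_bigr => j _.
  rewrite (linZ (dpow_linear i)) scalerA dpow_dpow -exprD /g (addnA n i j).
  congr (_ *: _); apply: signr_eq; rewrite !oddD.
  by case: (odd n); case: (odd i); case: (odd j).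
rewrite -sum_triangle_widen; last first.
  move=> k l kl; rewrite /g w0' ?(lin0 (dpow_linear _)) ?mul0rn ?scaler0//.
  exact/(leq_trans kl)/leq_addl.
rewrite big_nat_recl// big_nat1 /g expr0 scale1r dpow0 addn0 bin0 mulr1n.
rewrite big1 ?addr0// => s _.
transitivity (\sum_(0 <= k < s.+2)
    ((-1) ^+ (s.+1 - k) *: dpow s.+1 (w (n + s.+1)%N)) *+ 'C(s.+1, k)).
  by apply: eq_big_nat => k /= ks; rewrite subnKC// scalerMnr.
rewrite sum_binS big_nat big1// => k /= ks.
by rewrite subSn// exprS mulN1r scaleNr subSS addNr mul0rn.
Qed.

(** The hypothesis on [D] makes [B k] equal to [ad(D)^k (B 0) / k!], so that [exp(t D) (B 0)] is the
    sum of the [t^k (B k) exp(t D)]; this moves [B 0] out of the transform. *)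
Lemma skew_commutator (B : nat -> A -> A) N w n :
  (forall k, linear (B k)) ->
  (forall k x, D (B k x) = B k (D x) + B k.+1 x *+ k.+1) ->
  (forall i, (N <= i)%N -> w i = 0) ->
  skew (fun m => B 0 (w m)) n = \sum_(0 <= k < N) B k (skew w (n + k)%N).
Proof.
move=> BL BD w0.
(* The coefficient of [t^i] in this commutation. The induction compares multiples by [i + 1], split
   as [(i + 1 - k) + k]. *)
have dpB i x : dpow i (B 0 x) = \sum_(0 <= k < i.+1) B k (dpow (i - k) x).
  elim: i x => [|i IH] x; first by rewrite big_nat1 !dpow0.
  apply: (scalerI (a := i.+1%:R : F)); first by rewrite pnatr_eq0.
  rewrite !scaler_nat -D_dpow IH linear_sum/=.
  under eq_bigr do rewrite BD D_dpow (linMn (BL _)).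
  rewrite big_split/= -sumrMnl.
  rewrite [RHS](eq_big_nat _ _ (F2 := fun k => B k (dpow (i.+1 - k) x) *+ (i.+1 - k)
    + B k (dpow (i.+1 - k) x) *+ k)); last first.
    by move=> k /= ks; rewrite -mulrnDr subnK.
  rewrite big_split/=; congr (_ + _).
    rewrite [RHS]big_nat_recr//= subnn addr0.
    by apply: eq_big_nat => k /= ks; rewrite subSn.
  by rewrite [RHS]big_nat_recl//= add0r; apply: eq_bigr => k _; rewrite subSS.
rewrite (@skew_nat N); last by move=> i /w0 ->; rewrite (lin0 (BL 0)).
transitivity (\sum_(0 <= s < N) \sum_(0 <= k < s.+1)
    B k ((-1) ^+ (n + k + (s - k) + 1) *: dpow (s - k) (w (n + k + (s - k))%N))).
  apply: eq_bigr => s _; rewrite dpB scaler_sumr; apply: eq_big_nat => k /= ks.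
  by rewrite [RHS](linZ (BL _)) -(addnA n k) subnKC.
rewrite (sum_triangle_widen (g := fun k l =>
  B k ((-1) ^+ (n + k + l + 1) *: dpow l (w (n + k + l)%N)))).
  by apply: eq_bigr => k _; rewrite -(lin_sum (BL k)) -skew_nat.
move=> k l kl; rewrite w0 ?(lin0 (dpow_linear _)) ?scaler0 ?(lin0 (BL _))//.
by rewrite -addnA (leq_trans kl)// leq_addl.
Qed.

End SkewSum.

(** With [S] and [T] the shifts of the two indices of [Z], the inner sum is [(S - T)^i], and the
    identity is [(T + (S - T))^m = S^m]. *)
Lemma binomial_inversion (F : pzRingType) (V : lmodType F)
    (Z : nat -> nat -> V) m n :
  \sum_(0 <= i < m.+1)
    (\sum_(0 <= k < i.+1)
       ((-1) ^+ k *: Z (i - k)%N (m + n - i + k)%N) *+ 'C(i, k)) *+ 'C(m, i) =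
  Z m n.
Proof.
pose W Z i q : V :=
  \sum_(0 <= k < i.+1) ((-1) ^+ k *: Z (i - k)%N (q + k)%N) *+ 'C(i, k).
rewrite -[LHS]/(\sum_(0 <= i < m.+1) W Z i (m + n - i)%N *+ 'C(m, i)).
elim: m Z => [|m IH] Z.
  by rewrite big_nat1 /W big_nat1 !bin0 !mulr1n expr0 scale1r !subn0 addn0.
have WS i q : W Z i.+1 q = W (fun x => Z x.+1) i q - W Z i q.+1.
  rewrite /W sum_binS -sumrB; apply: eq_big_nat => k /= ki.
  by rewrite -mulrnBl exprS mulN1r scaleNr subSS subSn// addSnnS.
rewrite sum_binS -(IH (fun x => Z x.+1)); apply: eq_big_nat => i /= im.
have imn : (i <= m + n)%N by apply: leq_trans (leq_addr _ _).
by rewrite addSn subSS WS (subSn imn) addrC subrK.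
Qed.

(** * Skew-symmetry and permutations of the Jacobi identity *)

Section VertexLieIdentities.
Variables (F : numFieldType) (A : lmodType F) (D : {linear A -> A}).
Variable Y : nat -> A -> A -> A.
Hypothesis Ypolar : linear_to_polar Y.
Hypothesis Yder : forall n a b, Y n (D a) b = - (Y n.-1 a b *+ n).
Hypothesis Yskew : forall n a b, Y n a b = skew D (fun m => Y m b a) n.

Let YlL n b : linear (fun a => Y n a b). Proof. exact: polar_linearl. Qed.
Let YrL n a : linear (Y n a). Proof. exact: polar_linearr. Qed.

Lemma polar_finite a b : finite_seq (fun n => Y n a b).
Proof. exact: polar_trunc. Qed.

(** This is (C1) carried to the right argument by skew-symmetry; together with (C1) it makes [D] a
    derivation of every product. *)
Lemma vla_derr n a b : Y n a (D b) = D (Y n a b) + Y n.-1 a b *+ n.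
Proof.
have fin := polar_finite b a.
have fin' : finite_seq (fun m => Y m.-1 b a *+ m).
  by have [N N0] := fin; exists N.+1; case=> // m /N0 ->; rewrite mul0rn.
rewrite [LHS]Yskew (eq_skew _ _ (fun m => Yder m b a)) skewN// (skew_pred _ _ fin).
by rewrite opprK -!Yskew.
Qed.

Lemma vla_dpowl p k x c :
  Y p (dpow D k x) c = (-1) ^+ k *: (Y (p - k)%N x c *+ 'C(p, k)).
Proof.
elim: k p => [|k IH] p; first by rewrite dpow0 expr0 scale1r subn0 bin0.
apply: (scalerI (a := k.+1%:R : F)); first by rewrite pnatr_eq0.
rewrite !scaler_nat -(linMn (YlL p c)) -D_dpow Yder IH.
rewrite exprS mulN1r scaleNr mulNrn -!scalerMnr -!mulrnA.
by rewrite -subn1 -subnDA add1n subn1 mulnC mul_bin_diag mulnC.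
Qed.

Definition jacobi a b c := forall m n,
  Y m a (Y n b c) - Y n b (Y m a c) =
  \sum_(0 <= i < m.+1) Y (m + n - i)%N (Y i a b) c *+ 'C(m, i).

(** Since [b_i a] is the transform of [a_i b], this gives the antisymmetry of the right-hand side of
    (C3) under exchange of [(a, m)] and [(b, n)]. The base case is (C1) for divided powers. *)
Lemma jacobi_sum_skew x c m n : finite_seq x ->
  \sum_(0 <= i < n.+1) Y (n + m - i)%N (skew D x i) c *+ 'C(n, i) =
  - \sum_(0 <= i < m.+1) Y (m + n - i)%N (x i) c *+ 'C(m, i).
Proof.
elim: n x m => [|n IH] x m finx.
  rewrite big_nat1 bin0 mulr1n subn0 add0n addn0.
  have [N x0] := finx.
  have xN i : (N + m <= i)%N -> x i = 0.
    by move=> h; apply/x0/(leq_trans _ h)/leq_addr.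
  rewrite (skew_nat _ _ xN) (lin_sum (YlL m c)) -sumrN.
  (* Both sums are extended to a common range: past [m] the binomial coefficients vanish, past
     [N + m] the values of [x] do. *)
  rewrite -[RHS](sum_nat_widen (N := N + m.+1))//; first last.
  - by move=> i mi; rewrite bin_small ?mulr0n ?oppr0.
  - exact: leq_addl.
  rewrite -[LHS](sum_nat_widen (N := N + m.+1))//; first last.
  - by move=> i /xN xi; rewrite xi (lin0 (dpow_linear _ _)) scaler0 (lin0 (YlL m c)).
  - by rewrite addnS.
  apply: eq_bigr => i _; rewrite (linZ (YlL m c)) add0n vla_dpowl scalerA.
  rewrite -exprD -scaleN1r; congr (_ *: _); rewrite -[RHS]expr1.
  by apply: signr_eq; rewrite !oddD; case: (odd i).
have finS : finite_seq (fun i => x i.+1) := finite_seq_shift 1 finx.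
have skewS i : skew D x i.+1 = - skew D (fun i => x i.+1) i.
  by rewrite (skew_addl D 1 i finx) expr1 scaleN1r opprK.
(* Pascal's rule leaves two instances of the induction hypothesis: [x] with [m.+1], and the shifted
   sequence, whose transform has the opposite sign. *)
transitivity
  (\sum_(0 <= i < n.+1) Y (n + m.+1 - i)%N (skew D x i) c *+ 'C(n, i) -
   \sum_(0 <= i < n.+1) Y (n + m - i)%N (skew D (fun i => x i.+1) i) c *+ 'C(n, i)).
  rewrite sum_binS -sumrB; apply: eq_bigr => i _.
  by rewrite -mulrnBl skewS (linN (YlL _ c)) addSnnS addnS subSS.
rewrite !IH// sum_binS opprK -sumrN -sumrN -big_split/=.
apply: eq_bigr => i _.
by rewrite -mulNrn -mulrnDl addSnnS addnS subSS opprD -addrA addNr addr0 mulNrn.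
Qed.

Lemma jacobi_swap12 a b c : jacobi a b c -> jacobi b a c.
Proof.
move=> J m n; rewrite -opprB J -(jacobi_sum_skew _ _ _ (polar_finite a b)).
by apply: eq_bigr => i _; rewrite -Yskew.
Qed.

(* Computing [a_m b] on [w] through skew-symmetry turns the commutator formula
   for [a] and [w] into the iterate formula for [a] and [b]. *)
Lemma jacobi_iterate a b w m n : jacobi a w b ->
  Y n (Y m a b) w =
  \sum_(0 <= k < m.+1) ((-1) ^+ k *:
    (Y (m - k)%N a (Y (n + k)%N b w) - Y (n + k)%N b (Y (m - k)%N a w))) *+ 'C(m, k).
Proof.
move=> J.
(* By [vla_derr] this is [ad(D)^k (a_m) / k!], as [skew_commutator] requires. *)
pose B k x := (-1) ^+ k *: (Y (m - k)%N a x *+ 'C(m, k)).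
have BL k : linear (B k).
  by move=> e x y; rewrite /B YrL mulrnDl scalerDr !scalerMnr !scalerA mulrC.
have BD k x : D (B k x) = B k (D x) + B k.+1 x *+ k.+1.
  rewrite /B linearZ_LR raddfMn vla_derr mulrnDl scalerDr -!scalerMnr -!mulrnA.
  rewrite [in X in _ + X]mulnC mul_bin_left mulnC exprS mulN1r scaleNr mulNrn.
  by rewrite subnS addrK.
have fin := polar_finite w b.
rewrite Yskew.
(* The hypothesis [J] expresses [w_p (a_m b)] through [a_m (w_p b)]. *)
rewrite (eq_skew D (w' := fun p => Y m a (Y p w b) -
  \sum_(0 <= j < m.+1) Y (m - j + p)%N (Y j a w) b *+ 'C(m, j))); last first.
  move=> p; apply/eqP; rewrite eq_sym subr_eq addrC -subr_eq; apply/eqP.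
  by rewrite J; apply: eq_big_nat => j /= jm; rewrite addnBAC.
have finM k x y j : finite_seq (fun p => Y (k + p)%N x y *+ j).
  have [N N0] := finite_seq_shift k (polar_finite x y).
  by exists N => p /N0 ->; rewrite mul0rn.
have finYa : finite_seq (fun p => Y m a (Y p w b)).
  exact: (finite_seq_map (f := fun=> Y m a) (fun=> lin0 (YrL m a)) fin).
have finS : finite_seq
    (fun p => \sum_(0 <= j < m.+1) Y (m - j + p)%N (Y j a w) b *+ 'C(m, j)).
  exact: finite_seq_sum.
rewrite skewD ?skewN ?skew_sum//; last first.
  by have [N N0] := finS; exists N => p /N0 ->; rewrite oppr0.
have [N N0] := fin.
have -> : (fun p => Y m a (Y p w b)) = (fun p => B 0 (Y p w b)).
  by apply/funext => p; rewrite /B expr0 scale1r subn0 bin0.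
rewrite (skew_commutator (N := N + m.+1) _ BL BD); last first.
  by move=> i Ni; apply/N0/(leq_trans _ Ni)/leq_addr.
rewrite (sum_nat_widen (M := m.+1)); first last.
- by move=> i mi; rewrite /B bin_small// mulr0n scaler0.
- exact: leq_addl.
(* The reversal [j = m - k] pairs each subtracted term with the term of [B k]. *)
rewrite [X in _ - X]big_nat_rev add0n -sumrB; apply: eq_big_nat => k /= km.
rewrite /B -Yskew scalerBr mulrnBl -scalerMnr; congr (_ - _).
rewrite subSS skewMn; last exact: finite_seq_shift (polar_finite _ _).
rewrite bin_sub// subKn// (skew_addl D _ _ (polar_finite _ _)).
by rewrite -Yskew addnC.
Qed.

(** The iterate formula turns every term on the right of (C3) into commutators, and binomial
    inversion collapses them to a single one. *)
Lemma jacobi_swap23 a b c : jacobi a c b -> jacobi a b c.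
Proof.
move=> J m n.
rewrite -[LHS](binomial_inversion (fun p q => Y p a (Y q b c) - Y q b (Y p a c))).
by apply: eq_bigr => i _; rewrite jacobi_iterate.
Qed.

End VertexLieIdentities.

(** * Derivations of commutative algebras *)

Section Derivations.
Variables (F : fieldType) (A : comAlgType F).
Implicit Type d : A -> A.

Lemma derivation_scale_add e d d' : is_derivation d -> is_derivation d' ->
  is_derivation (fun x => e *: d x + d' x).
Proof.
move=> [dL dM] [d'L d'M]; split=> [c x y|x y].
  by rewrite dL d'L !scalerDr !scalerA (mulrC e) addrACA.
by rewrite dM d'M !scalerDr mulrDl mulrDr -!scalerAl -!scalerAr addrACA.
Qed.

Lemma derivation0 : is_derivation (fun=> 0 : A).
Proof. by split=> [c x y|x y]; rewrite ?scaler0 ?mul0r ?mulr0 addr0. Qed.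

Lemma derivationD d d' : is_derivation d -> is_derivation d' ->
  is_derivation (fun x => d x + d' x).
Proof.
move=> hd hd'; rewrite (_ : (fun _ => _) = (fun x => 1 *: d x + d' x)).
  exact: derivation_scale_add.
by apply/funext => x; rewrite scale1r.
Qed.

Lemma derivationZ e d : is_derivation d -> is_derivation (fun x => e *: d x).
Proof.
move=> hd; rewrite (_ : (fun _ => _) = (fun x => e *: d x + 0)).
  exact: derivation_scale_add derivation0.
by apply/funext => x; rewrite addr0.
Qed.

Lemma derivationMn n d : is_derivation d -> is_derivation (fun x => d x *+ n).
Proof.
move=> /(derivationZ n%:R); congr (is_derivation _).
by apply/funext => x; rewrite scaler_nat.
Qed.

Lemma derivation_sum M (d : nat -> A -> A) : (forall k, is_derivation (d k)) ->
  is_derivation (fun x => \sum_(0 <= k < M) d k x).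
Proof.
move=> hd; elim: M => [|M IH].
  have := derivation0; congr (is_derivation _).
  by apply/funext => x; rewrite big_geq.
have := derivationD IH (hd M); congr (is_derivation _).
by apply/funext => x; rewrite big_nat_recr.
Qed.

Lemma derivation_commutator d d' : is_derivation d -> is_derivation d' ->
  is_derivation (fun x => d (d' x) - d' (d x)).
Proof.
move=> [dL dM] [d'L d'M]; split=> [c x y|x y].
  by rewrite d'L dL dL d'L opprD addrACA scalerBr.
by rewrite d'M dM (linD dL) (linD d'L) !dM !d'M; ring.
Qed.

Lemma derivation1 d : is_derivation d -> d 1 = 0.
Proof.
move=> [_ dM]; apply: (addrI (d 1)).
by rewrite addr0 -[in RHS](mulr1 1) dM mulr1 mul1r.
Qed.

Lemma derivation_scalar d e : is_derivation d -> d e%:A = 0.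
Proof. by move=> hd; rewrite (linZ hd.1) derivation1// scaler0. Qed.

End Derivations.

(** * Derivations of the symmetric algebra *)

HB.instance Definition _ (F : fieldType) (V : lmodType F)
    (f : {linear V -> symalg V}) :=
  GRing.isLinear.Build F (symalg V) (symalg V) *:%R (symder f)
    (symder_derivation f).1.

Section SymmetricAlgebraDerivations.
Variables (F : fieldType) (V : lmodType F).

Lemma derivation_ext (d d' : symalg V -> symalg V) :
  is_derivation d -> is_derivation d' ->
  (forall v, d (symgen v) = d' (symgen v)) -> d =1 d'.
Proof.
move=> hd hd' dd'; apply: symalg_ind => // [e|x y ex ey|x y ex ey].
- by rewrite !derivation_scalar.
- by rewrite (linD hd.1) (linD hd'.1) ex ey.
- by rewrite hd.2 hd'.2 ex ey.
Qed.

Variables (f : V -> symalg V) (fL : linear f).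

Let f' : {linear V -> symalg V} :=
  HB.pack f (GRing.isLinear.Build F V (symalg V) *:%R f fL).

Lemma linear_symder_gen v : symder f (symgen v) = f v.
Proof. exact: (symder_gen f'). Qed.

Lemma linear_symder_derivation : is_derivation (symder f).
Proof. exact: (symder_derivation f'). Qed.

End SymmetricAlgebraDerivations.

(** Serves to compare skew-symmetry in [R] and in [S(R)], with the embedding of the generators as
    [f]. *)
Lemma skew_morphism (F : numFieldType) (A B : lmodType F)
    (D : {linear A -> A}) (E : {linear B -> B}) (f : {linear A -> B}) w n :
  (forall x, f (D x) = E (f x)) -> finite_seq w ->
  skew E (fun m => f (w m)) n = f (skew D w n).
Proof.
move=> fD [N w0]; rewrite (skew_nat D n w0) (@skew_nat _ _ E N); last first.
  by move=> i /w0 ->; rewrite linear0.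
have fiter i x : f (iter i D x) = iter i E (f x) by elim: i => //= i <-.
rewrite linear_sum/=; apply: eq_bigr => i _.
by rewrite (linearZ_LR f) /dpow (linearZ_LR f) fiter.
Qed.

(** * The skew-symmetry transform of a product *)

Section ShiftedProduct.
Variables (F : numFieldType) (A : comAlgType F) (D : {linear A -> A}).
Hypothesis Dder : is_derivation D.

(* With w(x) the sum of the w_n x^n / n!, these are the coefficients of
   w(x + D) c, where D acts on c only. *)
Definition shift_mul (w : nat -> A) c n : A :=
  \sum_(i \in [set: nat]) w (n + i)%N * dpow D i c.

Lemma shift_mul_nat N w c n : (forall i, (N <= i)%N -> w i = 0) ->
  shift_mul w c n = \sum_(0 <= i < N) w (n + i)%N * dpow D i c.
Proof.
move=> w0; apply: fsum_nat => i Ni.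
by rewrite w0 ?mul0r//; apply/(leq_trans Ni)/leq_addl.
Qed.

Lemma shift_mul_comb x y w w' c n : finite_seq w -> finite_seq w' ->
  shift_mul (fun m => x * w m + y * w' m) c n =
  x * shift_mul w c n + y * shift_mul w' c n.
Proof.
move=> hw hw'; have [N w0] := finite_seq2 hw hw'.
have wN i : (N <= i)%N -> w i = 0 by move=> /w0[].
have w'N i : (N <= i)%N -> w' i = 0 by move=> /w0[].
rewrite (shift_mul_nat _ _ wN) (shift_mul_nat _ _ w'N) (@shift_mul_nat N).
  rewrite !mulr_sumr -big_split/=; apply: eq_bigr => i _.
  by rewrite mulrDl !mulrA.
by move=> i Ni; rewrite wN// w'N// !mulr0 addr0.
Qed.

(** Conjugation by [exp(t D)] turns multiplication by [c] into multiplication by [exp(t D) c]; the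
    Leibniz rule is what [skew_commutator] asks for. *)
Lemma skew_mul w c n : finite_seq w ->
  skew D (fun m => w m * c) n = shift_mul (skew D w) c n.
Proof.
move=> [N w0]; rewrite (@shift_mul_nat N); last by move=> i; apply: skew_eq0.
rewrite -(skew_commutator (B := fun k x => x * dpow D k c))//.
- by apply: eq_skew => m; rewrite dpow0.
- by move=> k e x y; rewrite mulrDl scalerAl.
- by move=> k x; rewrite Dder.2 D_dpow -mulrnAr.
Qed.

End ShiftedProduct.

(** * Construction of the vertex Poisson structure on the symmetric algebra *)

Section PoissonExtension.
Variables (F : numFieldType) (R : lmodType F) (dR : {linear R -> R}).
Variable Y0 : nat -> R -> R -> R.
Hypothesis Y0vla : vertex_Lie_algebra dR Y0.

Let D : {linear symalg R -> symalg R} := symder (@symgen F R \o dR).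
Let sg : {linear R -> symalg R} := @symgen F R.

Let Dder : is_derivation D. Proof. exact: symder_derivation. Qed.
Let Dgen v : D (sg v) = sg (dR v). Proof. exact: symder_gen. Qed.

Let Y0fin u v : finite_seq (fun n => Y0 n u v).
Proof. exact: polar_finite (vla_polar Y0vla) _ _. Qed.

Definition gen_bracket n u : symalg R -> symalg R :=
  symder (fun v => symgen (Y0 n u v)).

Let gen_linear n u : linear (fun v => sg (Y0 n u v)).
Proof. by move=> e x y; rewrite (polar_linearr (vla_polar Y0vla)) linearP. Qed.

Lemma gen_bracket_gen n u v : gen_bracket n u (sg v) = sg (Y0 n u v).
Proof. exact: linear_symder_gen (gen_linear n u) v. Qed.

Lemma gen_bracket_der n u : is_derivation (gen_bracket n u).
Proof. exact: linear_symder_derivation (gen_linear n u). Qed.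

Lemma gen_bracket_linear n a : linear (fun u => gen_bracket n u a).
Proof.
move=> e u v; apply: (derivation_ext (d := gen_bracket n (e *: u + v)) _
  (derivation_scale_add e (gen_bracket_der n u) (gen_bracket_der n v))).
  exact: gen_bracket_der.
by move=> w; rewrite !gen_bracket_gen (polar_linearl (vla_polar Y0vla)) linearP.
Qed.

(** The Leibniz rule for [d n] involves the single index [n], so a common bound for two factors also
    bounds their product. *)
Lemma derivation_finite (d : nat -> symalg R -> symalg R) :
  (forall n, is_derivation (d n)) ->
  (forall v, finite_seq (fun n => d n (sg v))) ->
  forall a, finite_seq (fun n => d n a).
Proof.
move=> hd hv; apply: symalg_ind => // [e|x y hx hy|x y hx hy].
- by exists 0%N => n _; apply: derivation_scalar.
- have [N h] := finite_seqD hx hy.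
  by exists N => n /h; rewrite (linD (hd n).1).
- have [N h] := finite_seq2 hx hy.
  by exists N => n /h[hxn hyn]; rewrite (hd n).2 hxn hyn mul0r mulr0 addr0.
Qed.

Lemma gen_bracket_finite u a : finite_seq (fun n => gen_bracket n u a).
Proof.
apply: (derivation_finite (d := fun n => gen_bracket n u)) => [n|v].
  exact: gen_bracket_der.
have [N h] := Y0fin u v; exists N => n /h E.
by rewrite gen_bracket_gen E linear0.
Qed.

(** Read as [[u_n, D] = n u_(n-1)], this equates two derivations, and on generators it is [vla_derr]
    in [R]. *)
Lemma gen_bracket_D n u a :
  gen_bracket n u (D a) = D (gen_bracket n u a) + gen_bracket n.-1 u a *+ n.
Proof.
apply/eqP; rewrite addrC -subr_eq; apply/eqP.
apply: (derivation_ext (derivation_commutator (gen_bracket_der n u) Dder)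
  (derivationMn n (gen_bracket_der n.-1 u))) => v.
rewrite Dgen !gen_bracket_gen Dgen -linearB -linearMn/=; congr symgen.
by rewrite (vla_derr (vla_polar Y0vla) (vla_der Y0vla) (vla_skew Y0vla)) addrC addKr.
Qed.

(** The values on generators are those that skew-symmetry imposes once every [v_m] is known on
    [S(R)]. *)
Definition poisson_bracket n a : symalg R -> symalg R :=
  symder (fun v => skew D (fun m => gen_bracket m v a) n).
Local Notation Y := poisson_bracket.

Let bracket_gen_linear n a :
  linear (fun v => skew D (fun m => gen_bracket m v a) n).
Proof.
move=> e u v; rewrite -skew_linear; try exact: gen_bracket_finite.
by apply: eq_skew => m; apply: gen_bracket_linear.
Qed.

Lemma bracket_gen n a v : Y n a (sg v) = skew D (fun m => gen_bracket m v a) n.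
Proof. exact: linear_symder_gen (bracket_gen_linear n a) v. Qed.

Lemma bracket_der n a : is_derivation (Y n a).
Proof. exact: linear_symder_derivation (bracket_gen_linear n a). Qed.

Lemma bracket_linear n b : linear (fun a => Y n a b).
Proof.
move=> e x y; apply: (derivation_ext (d := Y n (e *: x + y)) _
  (derivation_scale_add e (bracket_der n x) (bracket_der n y))).
  exact: bracket_der.
move=> v; rewrite !bracket_gen -skew_linear; try exact: gen_bracket_finite.
by apply: eq_skew => m; rewrite (gen_bracket_der m v).1.
Qed.

Lemma bracket_finite a b : finite_seq (fun n => Y n a b).
Proof.
apply: (derivation_finite (d := Y^~ a)) => [n|v]; first exact: bracket_der.
have [N h] := skew_finite D (gen_bracket_finite v a).
by exists N => n /h; rewrite bracket_gen.
Qed.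

Lemma bracket_polar : linear_to_polar Y.
Proof.
split; [exact: bracket_linear | by move=> n a; case: (bracket_der n a) |].
exact: bracket_finite.
Qed.

(** The two constructions of [u_n] agree because (C2) holds in [R]. *)
Lemma bracket_genl n u : Y n (sg u) =1 gen_bracket n u.
Proof.
apply: derivation_ext; [exact: bracket_der | exact: gen_bracket_der |] => v.
have Y0skew : Y0 n u v = skew dR (fun m => Y0 m v u) n := vla_skew Y0vla n u v.
rewrite bracket_gen gen_bracket_gen Y0skew.
rewrite -(skew_morphism (f := sg) n (fun x => esym (Dgen x)) (Y0fin v u)).
by apply: eq_skew => m; rewrite gen_bracket_gen.
Qed.

Lemma bracket_extends : polar_extends Y0 Y.
Proof. by move=> n u v; rewrite (bracket_genl n u) gen_bracket_gen. Qed.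

Lemma bracket_Dl n a b : Y n (D a) b = - (Y n.-1 a b *+ n).
Proof.
rewrite -scaler_nat -scaleNr.
apply: (derivation_ext (bracket_der n (D a)) (derivationZ _ (bracket_der n.-1 a))).
move=> v; rewrite !bracket_gen scaleNr scaler_nat.
have fin := gen_bracket_finite v a.
have fin' : finite_seq (fun m => gen_bracket m.-1 v a *+ m).
  by have [N h] := fin; exists N.+1; case=> // m /h ->; rewrite mul0rn.
rewrite (eq_skew D n (fun m => gen_bracket_D m v a)) skewD//; last first.
  exact: (finite_seq_map (f := fun=> D) (fun=> linear0 D) fin).
(* The [D] term cancels against the one produced by [skew_pred]. *)
by rewrite skew_D// (skew_pred _ _ fin) opprD addrA subrr sub0r.
Qed.

(** Both sides are derivations in [c]; at a generator [v] the identity is the transform of the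
    Leibniz rule for [v_m (a b)]. *)
Lemma bracket_mull n a b c :
  Y n (a * b) c =
  shift_mul D (fun m => Y m a c) b n + shift_mul D (fun m => Y m b c) a n.
Proof.
(* [shift_mul] is linear over the whole algebra in its sequence, so it preserves the Leibniz rule in
   [c']. *)
have shift_der a' b' : is_derivation (fun c' => shift_mul D (fun m => Y m a' c') b' n).
  split=> [e x y|x y].
    have := @shift_mul_comb _ _ D e%:A 1 _ _ b' n
      (bracket_finite a' x) (bracket_finite a' y).
    rewrite mulr_algl mul1r => <-; congr shift_mul; apply/funext => m.
    by rewrite (bracket_der m a').1 mulr_algl mul1r.
  rewrite [X in X + _]mulrC -shift_mul_comb; try exact: bracket_finite.
  congr shift_mul; apply/funext => m.
  by rewrite (bracket_der m a').2 [X in X + _]mulrC.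
apply: (derivation_ext (bracket_der n (a * b))
  (derivationD (shift_der a b) (shift_der b a))) => v.
have finM x y : finite_seq (fun m => gen_bracket m v x * y).
  by have [N h] := gen_bracket_finite v x; exists N => m /h ->; rewrite mul0r.
rewrite bracket_gen (eq_skew D n (fun m => (gen_bracket_der m v).2 a b)).
under eq_skew do rewrite [a * _]mulrC.
rewrite skewD// !skew_mul//; try exact: gen_bracket_finite.
by congr (shift_mul D _ _ _ + shift_mul D _ _ _); apply/funext => m;
  rewrite bracket_gen.
Qed.

Lemma bracket_skew n a b : Y n a b = skew D (fun m => Y m b a) n.
Proof.
elim/symalg_ind: b n => [v|e|x y hx hy|x y hx hy] n.
- by rewrite bracket_gen; apply: eq_skew => m; rewrite (bracket_genl m v).
(* Both sides vanish: [a_n] kills scalars, and [1_m] is zero because every [v_p] kills 1. *)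
- rewrite derivation_scalar; last exact: bracket_der.
  rewrite -[LHS](skew0 D n); apply: eq_skew => m.
  rewrite (linZ (bracket_linear m a)).
  rewrite (derivation_ext (bracket_der m 1) (derivation0 _)) ?scaler0// => v.
  rewrite bracket_gen -[RHS](skew0 D m); apply: eq_skew => p.
  by rewrite derivation1//; apply: gen_bracket_der.
- rewrite (linD (bracket_der n a).1) hx hy -skewD; try exact: bracket_finite.
  by apply: eq_skew => m; rewrite (linD (bracket_linear m a)).
- rewrite (bracket_der n a).2.
  (* The involution inverts the induction hypotheses, so the left Leibniz rule presents [(x y)_m a]
     as a transform; a second transform leaves [(a_n x) y + x (a_n y)]. *)
  have swap z : (forall n, Y n a z = skew D (fun m => Y m z a) n) ->
      (fun m => Y m z a) = skew D (fun m => Y m a z).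
    move=> hz; apply/funext => m; rewrite -(skewK D m (bracket_finite z a)).
    by apply: eq_skew => p; rewrite hz.
  rewrite (eq_skew D n (fun m => bracket_mull m x y a)) (swap x hx) (swap y hy).
  have finM z z' : finite_seq (fun m => Y m a z * z').
    by have [N h] := bracket_finite a z; exists N => m /h ->; rewrite mul0r.
  rewrite -(eq_skew D n (fun m => congr2 +%R
    (skew_mul Dder y m (bracket_finite a x)) (skew_mul Dder x m (bracket_finite a y)))).
  rewrite skewD; try exact: skew_finite.
  by rewrite !skewK// [x * _]mulrC.
Qed.

Lemma jacobi_gen a b : (forall w, jacobi Y a b (sg w)) ->
  forall c, jacobi Y a b c.
Proof.
move=> J c m n.
apply: (derivation_ext
  (derivation_commutator (bracket_der m a) (bracket_der n b))
  (derivation_sum m.+1 (fun i => derivationMn 'C(m, i)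
    (bracket_der (m + n - i) (Y i a b))))) => w.
exact: J.
Qed.

Lemma bracket_jacobi a b c : jacobi Y a b c.
Proof.
pose swap23 := jacobi_swap23 bracket_polar bracket_Dl bracket_skew.
pose swap12 := jacobi_swap12 bracket_polar bracket_Dl bracket_skew.
have J1 u v w : jacobi Y (sg u) (sg v) (sg w).
  move=> m n; rewrite !bracket_extends -linearB (vla_comm Y0vla) linear_sum/=.
  by apply: eq_bigr => i _; rewrite linearMn/= !bracket_extends.
(* Each of [x] and [y] is reduced to a generator while standing in the last place. *)
have J2 u x y : jacobi Y (sg u) x y.
  by apply: jacobi_gen => v; apply/swap23/jacobi_gen => w; apply: J1.
(* Once [c] is a generator, the two exchanges bring it to the front. *)
by apply: jacobi_gen => u; apply/swap23/swap12/J2.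
Qed.

Lemma poisson_bracket_vpa : vertex_Poisson_algebra D Y.
Proof.
split; [exact: Dder | split | by move=> n a; case: (bracket_der n a)].
- by case: Dder.
- exact: bracket_polar.
- exact: bracket_Dl.
- exact: bracket_skew.
- by move=> m n a b c; apply: bracket_jacobi.
Qed.

End PoissonExtension.

(** * Restriction to generators, uniqueness and conclusion *)

Lemma vertex_Lie_algebra_restrict (F : numFieldType) (R : lmodType F)
    (dR : {linear R -> R}) (Y0 : nat -> R -> R -> R)
    (Y : nat -> symalg R -> symalg R -> symalg R) :
  linear_to_polar Y0 -> vertex_Lie_algebra (symder (@symgen _ R \o dR)) Y ->
  polar_extends Y0 Y -> vertex_Lie_algebra dR Y0.
Proof.
move=> Y0polar Yvla Yext.
have Dgen v : symgen (dR v) = symder (@symgen _ R \o dR) (symgen v).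
  by rewrite symder_gen.
split=> [|//|n a b|n a b|m n a b c].
- exact: linearP.
- apply: symgen_inj; rewrite -Yext Dgen (vla_der Yvla) Yext.
  by rewrite [RHS]linearN [in RHS]linearMn.
(* Truncation of [Y0] makes the sum in [R] finite, so the embedding carries it to the sum in
   [S(R)]. *)
- apply: symgen_inj; rewrite -/(skew dR (fun m => Y0 m b a) n).
  rewrite -(skew_morphism (f := @symgen F R) n Dgen (polar_finite Y0polar b a)).
  rewrite -Yext (vla_skew Yvla); apply: eq_fsbigr => m _.
  by rewrite Yext.
- apply: symgen_inj; rewrite linearB linear_sum/= -!Yext (vla_comm Yvla).
  by apply: eq_bigr => i _; rewrite linearMn/= !Yext.
Qed.

Lemma vertex_Poisson_extension_unique (F : numFieldType) (R : lmodType F)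
    (D : symalg R -> symalg R) (Y0 : nat -> R -> R -> R)
    (Y1 Y2 : nat -> symalg R -> symalg R -> symalg R) :
  vertex_Poisson_algebra D Y1 -> polar_extends Y0 Y1 ->
  vertex_Poisson_algebra D Y2 -> polar_extends Y0 Y2 -> Y1 = Y2.
Proof.
move=> V1 ext1 V2 ext2.
have der Y (VY : vertex_Poisson_algebra D Y) n a : is_derivation (Y n a).
  by split; [exact: polar_linearr (vla_polar (vpa_vla VY)) n a | exact: (vpa_leibniz VY)].
have eq_gen n u : Y1 n (symgen u) =1 Y2 n (symgen u).
  apply: derivation_ext; [exact: der | exact: der |] => v.
  by rewrite ext1 ext2.
apply/funext => n; apply/funext => a; apply/funext => b.
apply: (derivation_ext (der _ V1 n a) (der _ V2 n a)) => v.
(* Skew-symmetry moves the generator to the left, where both products agree by [eq_gen]. *)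
rewrite (vla_skew (vpa_vla V1)) (vla_skew (vpa_vla V2)).
by apply: eq_fsbigr => i _; rewrite eq_gen.
Qed.

Theorem proposition3p7 (K : realType) (R : lmodType K[i])
    (dR : {linear R -> R}) (Y0 : nat -> R -> R -> R)
    (hY0 : linear_to_polar Y0) :
  let D := symder (@symgen _ R \o dR) in
  ((exists Y : nat -> symalg R -> symalg R -> symalg R,
      vertex_Poisson_algebra D Y /\ polar_extends Y0 Y) <->
   vertex_Lie_algebra dR Y0) /\
  (forall Y1 Y2 : nat -> symalg R -> symalg R -> symalg R,
      vertex_Poisson_algebra D Y1 -> polar_extends Y0 Y1 ->
      vertex_Poisson_algebra D Y2 -> polar_extends Y0 Y2 ->
      Y1 = Y2).
Proof.
move=> D; split; last exact: vertex_Poisson_extension_unique.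
split=> [[Y [Yvpa Yext]]|Y0vla].
  exact: vertex_Lie_algebra_restrict hY0 (vpa_vla Yvpa) Yext.
exists (poisson_bracket dR Y0); split.
  exact: poisson_bracket_vpa.
exact: bracket_extends.
Qed.
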